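(* In the setting of the context, suppose the regularity assumption and the local worst-case oracle assumption hold, and fix $x\in\mathcal X$ (write $\ell_k(z)=\ell_k(x,z)$), $i\in[N]$, $1\le k_1<k_2\le K$ and $b\in\mathbb R_+$. Let $$\Psi_i^{(k_1,k_2)}(\alpha,\beta)=\max_{v_1,v_2}\Big\{\alpha_1\ell_{k_1}(\hat z_i+v_1)+\alpha_2\ell_{k_2}(\hat z_i+v_2): v_j\in\mathbb R^m,\ \hat z_i+v_j\in\mathcal Z,\ \alpha_jc(\hat z_i+v_j,\hat z_i)\le\beta_j,\ j\in\{1,2\}\Big\}$$ and $\Phi_i^{(k_1,k_2)}(\alpha)=\max\{\Psi_i^{(k_1,k_2)}(\alpha,\beta):\beta\in\mathbb R_+^2,\beta_1+\beta_2=b\}$. Then for any $\alpha,\alpha'\in\mathbb R_{++}^2$ with $\alpha_1+\alpha_2=\alpha_1'+\alpha_2'=1$, $$\Big|\Phi_i^{(k_1,k_2)}(\alpha)-\Phi_i^{(k_1,k_2)}(\alpha')\Big|\le\begin{cases}(R_i+2C_i)|\alpha_1-\alpha_1'|+2g\,b^r|\alpha_1-\alpha_1'|^{1-r}&\text{if }p=1,\\ R_i|\alpha_1-\alpha_1'|+2G_ib^{1/p}|\alpha_1-\alpha_1'|^{1-1/p}&\text{if }p>1,\end{cases}$$ where $R_i:=\max_{1\le k<k'\le K}|\ell_k(\hat z_i)-\ell_{k'}(\hat z_i)|$, $C_i:=\max_{k\in[K]}\{g+g\|\hat z_i-\hat z_0\|^r-\ell_k(\hat z_i)\}$, $G_i:=\max_{k\in[K]}\max\{\|\xi\|_*:\xi\in\partial\ell_k(\hat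 z_i)\}$, and $g,\hat z_0,r$ are the constant, reference point and exponent from part (iii) of the regularity assumption for the fixed $x$ (case $p=1$).
   Context: Notation: $[n]=\{1,\dots,n\}$; $\mathbb R_{++}$ is the set of positive reals; $\mathcal P(\mathcal Z)$ is the set of Borel probability measures on $\mathcal Z$; $\|\cdot\|_*$ is the dual norm of the norm $\|\cdot\|$ below; $\partial\ell_k(\hat z_i)$ is the superdifferential of the concave function $\ell_k$ at $\hat z_i$; $0^0=1$. Setting. $\mathcal X\subseteq\mathbb R^n$, $\mathcal Z\subseteq\mathbb R^m$. A transportation cost $c:\mathcal Z\times\mathcal Z\to\mathbb R_+$ is lower semicontinuous, satisfies $c(z,z)=0$ for all $z$, and $c(\cdot,\hat z)$ is convex for every fixed $\hat z\in\mathcal Z$. The optimal transport discrepancy is $\mathrm{OT}_c(\mathbb P,\mathbb Q)=\min_{\gamma}\mathbb E_{(z,\hat z)\sim\gamma}[c(z,\hat z)]$ over couplings $\gamma$ of $\mathbb P$ and $\mathbb Q$. Given $\hat z_1,\dots,\hat z_N\in\mathcal Z$, let $\hat{\mathbb P}=\frac1N\sum_{i=1}^N\delta_{\hat z_i}$; given $\rho>0$, let $\mathcal P=\{\mathbb P\in\mathcal P(\mathcal Z):\mathrm{OT}_c(\mathbb P,\hat{\mathbb P})\le\rho\}$. Regularity assumption. (i) $\mathcal X$ is nonempty and convex; there exist $\mathbb Q_0\in\mathcal P$ and $x_0\in\mathcal X$ such that $x\mapsto\mathbb E_{z\sim\mathbb Q_0}[\ell(x,z)]$ is inf-compact on $\mathcal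 X$ (all sublevel sets are compact) and $\mathbb E_{z\sim\mathbb Q_0}[\ell(x_0,z)]>-\infty$; $\mathcal Z$ is nonempty, closed and convex. (ii) $\ell(x,z)=\max_{k\in[K]}\ell_k(x,z)$ with $K\ge2$, where each $\ell_k:\mathbb R^n\times\mathbb R^m\to\mathbb R$ is real-valued, convex in its first and concave in its second argument. (iii) There exist a norm $\|\cdot\|$ on $\mathbb R^m$ and $p\ge1$ with $c(z,\hat z)\ge\|z-\hat z\|^p$ for all $z,\hat z\in\mathcal Z$; moreover, if $p=1$, then for every $x\in\mathcal X$ there exist $g>0$, $\hat z_0\in\mathcal Z$ and $r\in[0,1)$ such that $\ell(x,z)\le g[1+\|z-\hat z_0\|^r]$ for all $z\in\mathcal Z$. Local worst-case oracle assumption. For any $k\in[K]$, $\hat z\in\mathcal Z$, radius $u\ge0$ and accuracy $\epsilon>0$ there is an algorithm that returns $\hat v\in\mathbb R^m$ with $\hat z+\hat v\in\mathcal Z$, $c(\hat z+\hat v,\hat z)\le u$, together with $\hat L=\ell_k(\hat z+\hat v)\ge\max\{\ell_k(\hat z+v):v\in\mathbb R^m,\hat z+v\in\mathcal Z,c(\hat z+v,\hat z)\le u\}-\epsilon$. *)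

(* Defs.v *)
(* R^n is represented by the row vectors 'rV[R]_n with their canonical topology. *)
From HB Require Import structures.
From mathcomp Require Import all_boot all_order all_algebra.
From mathcomp Require Import all_classical all_reals all_analysis.

Set Implicit Arguments.
Unset Strict Implicit.
Unset Printing Implicit Defensive.

Import Order.TTheory GRing.Theory Num.Theory.
Import numFieldNormedType.Exports.

Local Open Scope classical_set_scope.
Local Open Scope ring_scope.

(* "max S": the greatest element of S, not merely its supremum.  The default
   value 0 is taken only when S has no greatest element. *)
Definition maximum (R : realType) (S : set R) : R := xget 0 (S `&` ubound S).

Lemma maximumE (R : realType) (S : set R) (a : R) :
  S a -> ubound S a -> maximum S = a.
Proof.
move=> Sa ua; apply: xget_unique => // b [Sb ub].
by apply/eqP; rewrite eq_le ua// ub.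
Qed.

Lemma maximumP (R : realType) (S : set R) :
  (exists a, S a /\ ubound S a) -> S (maximum S) /\ ubound S (maximum S).
Proof. by move=> [a [Sa ua]]; rewrite (maximumE Sa ua). Qed.

Definition concave_function (R : realType) (V : lmodType R)
    (D : set (convex_lmodType V)) (f : V -> R) :=
  convex_function D (fun v => - f v).

Record is_norm (R : realType) m (nu : 'rV[R]_m -> R) : Prop := IsNorm {
  norm_triangle : forall v w, nu (v + w) <= nu v + nu w ;
  norm_homogeneous : forall a v, nu (a *: v) = `|a| * nu v ;
  norm_definite : forall v, nu v = 0 -> v = 0 }.

Definition dot (R : realType) m (v w : 'rV[R]_m) : R :=
  \sum_(j < m) v ord0 j * w ord0 j.

Definition dual_norm (R : realType) m (nu : 'rV[R]_m -> R) (xi : 'rV[R]_m) : R :=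
  sup [set dot xi v | v in [set v | nu v <= 1]].

Definition superdifferential (R : realType) m (f : 'rV[R]_m -> R)
    (z : 'rV[R]_m) : set 'rV[R]_m :=
  [set xi | forall w, f w <= f z + dot xi (w - z)].

Notation borel R m := (g_sigma_algebraType (@open 'rV[R]_m)).

Section empirical.
Context (R : realType) (m N : nat) (zhat : 'I_N -> borel R m).

Definition empirical (A : set (borel R m)) : \bar R :=
  ((N%:R^-1)%:E * \sum_(i < N) \d_(zhat i) A)%E.

Let mu : {measure set (borel R m) -> \bar R} :=
  mscale (N%:R^-1)%:nng (msum (fun k => \d_(nth point (codom zhat) k)) N).

Let empiricalE : empirical = mu.
Proof.
apply/funext => A; rewrite /empirical /mu /= /mscale /= /msum.
congr (_ * _)%E; apply: eq_bigr => i _.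
by rewrite (nth_map i) ?size_enum_ord// nth_ord_enum.
Qed.

Let empirical0 : empirical set0 = 0%E.
Proof. by rewrite empiricalE measure0. Qed.

Let empirical_ge0 A : (0 <= empirical A)%E.
Proof. by rewrite empiricalE measure_ge0. Qed.

Let empirical_sigma_additive : semi_sigma_additive empirical.
Proof. by rewrite empiricalE; exact: measure_semi_sigma_additive. Qed.

HB.instance Definition _ := isMeasure.Build _ _ _ empirical
  empirical0 empirical_ge0 empirical_sigma_additive.

End empirical.

Section optimal_transport.
Context (R : realType) (m : nat).
Implicit Types (Z : set 'rV[R]_m) (c : 'rV[R]_m -> 'rV[R]_m -> R).

(* c is only meaningful on Z x Z, whence the relative (subspace) topology. *)
Record transport_cost Z c : Prop := TransportCost {
  cost_ge0 : forall z zh, Z z -> Z zh -> 0 <= c z zh ;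
  cost_lsc : lower_semicontinuous
    (fun w : subspace (Z `*` Z) => (c w.1 w.2)%:E) ;
  cost_diag : forall z, Z z -> c z z = 0 ;
  cost_convex : forall zh, Z zh -> convex_function Z (c^~ zh) }.

Definition couplings (P Q : set (borel R m) -> \bar R) :
    set (probability (borel R m * borel R m)%type R) :=
  [set gam | forall A : set (borel R m), measurable A ->
     gam (A `*` [set: borel R m]) = P A /\ gam ([set: borel R m] `*` A) = Q A].

(* Laws on Z are laws on R^m giving Z mass 1, so that couplings charge only
   Z x Z.  The infimum is attained for a transport cost on a closed Z. *)
Definition OT Z c (P Q : {measure set (borel R m) -> \bar R}) : \bar R :=
  ereal_inf [set (\int[gam]_(w in Z `*` Z) (c w.1 w.2)%:E)%E
            | gam in couplings P Q].

Definition ambiguity_set Z c N (zhat : 'I_N -> 'rV[R]_m) (rho : R) :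
    set (probability (borel R m) R) :=
  [set Q : probability (borel R m) R | Q Z = 1%E /\ (OT Z c Q (empirical zhat) <= rho%:E)%E].

End optimal_transport.

Section regularity.
Context (R : realType) (n m K : nat).
Implicit Types (X : set 'rV[R]_n) (Z : set 'rV[R]_m).
Implicit Types (c : 'rV[R]_m -> 'rV[R]_m -> R) (nu : 'rV[R]_m -> R).
Implicit Types (ell : 'I_K -> 'rV[R]_n -> 'rV[R]_m -> R).

Definition loss ell (x : 'rV[R]_n) (z : 'rV[R]_m) : R :=
  maximum [set ell k x z | k in [set: 'I_K]].

Definition expected_loss ell Z (Q : probability (borel R m) R) x : \bar R :=
  (\int[Q]_(z in Z) (loss ell x z)%:E)%E.

Definition inf_compact X (f : 'rV[R]_n -> \bar R) :=
  forall t : R, compact [set x | X x /\ (f x <= t%:E)%E].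

Definition growth_bound Z nu (f : 'rV[R]_m -> R) (g : R) (z0 : 'rV[R]_m) (r : R) :=
  [/\ 0 < g, Z z0, 0 <= r < 1 &
      forall z, Z z -> f z <= g * (1 + nu (z - z0) `^ r)].

Record regularity X Z c N (zhat : 'I_N -> 'rV[R]_m) (rho : R) ell nu (p : R) :
    Prop := Regularity {
  reg_X_nonempty : X !=set0 ;
  reg_X_convex : convex_set X ;
  reg_inf_compact : exists Q0 x0, [/\ ambiguity_set Z c zhat rho Q0, X x0,
    inf_compact X (expected_loss ell Z Q0) &
    (-oo < expected_loss ell Z Q0 x0)%E] ;
  reg_Z_nonempty : Z !=set0 ;
  reg_Z_closed : closed Z ;
  reg_Z_convex : convex_set Z ;
  reg_K : (2 <= K)%N ;
  reg_ell_convex : forall k z, convex_function setT (fun x => ell k x z) ;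
  reg_ell_concave : forall k x, concave_function setT (ell k x) ;
  reg_norm : is_norm nu ;
  reg_p : 1 <= p ;
  reg_cost_growth : forall z zh, Z z -> Z zh -> nu (z - zh) `^ p <= c z zh ;
  reg_loss_growth : p = 1 -> forall x, X x ->
    exists g z0 r, growth_bound Z nu (loss ell x) g z0 r }.

End regularity.

Section local_problems.
Context (R : realType) (m K : nat).
Implicit Types (Z : set 'rV[R]_m) (c : 'rV[R]_m -> 'rV[R]_m -> R).
Implicit Types (f : 'I_K -> 'rV[R]_m -> R) (nu : 'rV[R]_m -> R).

(* The algorithm is represented by its input-output map: O k zh u eps is the
   returned pair (perturbation, value). *)
Definition local_worst_case_oracle Z c f
    (O : 'I_K -> 'rV[R]_m -> R -> R -> 'rV[R]_m * R) :=
  forall k zh u eps, Z zh -> 0 <= u -> 0 < eps ->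
    let v := (O k zh u eps).1 in
    let L := (O k zh u eps).2 in
    [/\ Z (zh + v), c (zh + v) zh <= u, L = f k (zh + v) &
        maximum [set f k (zh + w) | w in [set w | Z (zh + w) /\ c (zh + w) zh <= u]]
          - eps <= L].

Definition Psi Z c (f1 f2 : 'rV[R]_m -> R) (zh : 'rV[R]_m) (alpha beta : R * R) : R :=
  maximum [set alpha.1 * f1 (zh + v.1) + alpha.2 * f2 (zh + v.2)
          | v in [set v : 'rV[R]_m * 'rV[R]_m |
              [/\ Z (zh + v.1), Z (zh + v.2),
                  alpha.1 * c (zh + v.1) zh <= beta.1 &
                  alpha.2 * c (zh + v.2) zh <= beta.2]]].

Definition Phi Z c (f1 f2 : 'rV[R]_m -> R) (zh : 'rV[R]_m) (b : R) (alpha : R * R) : R :=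
  maximum [set Psi Z c f1 f2 zh alpha beta
          | beta in [set beta : R * R |
              [/\ 0 <= beta.1, 0 <= beta.2 & beta.1 + beta.2 = b]]].

Definition Rconst f (zh : 'rV[R]_m) : R :=
  maximum [set `|f kk.1 zh - f kk.2 zh|
          | kk in [set kk : 'I_K * 'I_K | (kk.1 < kk.2)%N]].

Definition Cconst f nu (zh : 'rV[R]_m) (g : R) (z0 : 'rV[R]_m) (r : R) : R :=
  maximum [set g + g * nu (zh - z0) `^ r - f k zh | k in [set: 'I_K]].

Definition Gconst f nu (zh : 'rV[R]_m) : R :=
  maximum [set maximum [set dual_norm nu xi | xi in superdifferential (f k) zh]
          | k in [set: 'I_K]].

End local_problems.

(* Main.v *)
(* The budget split beta can be eliminated: Phi(alpha) is the maximum of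
   alpha_1 f_1(z_1) + alpha_2 f_2(z_2) over all z_1, z_2 in Z of total cost
   alpha_1 c(z_1, zh) + alpha_2 c(z_2, zh) <= b.  If alpha'_1 - alpha_1 = d >= 0,
   then moving an optimal z_1 towards zh by the factor alpha_1 / alpha'_1 and
   keeping z_2 gives a point feasible for alpha', and by convexity of c and
   concavity of f_1 the value drops by at most d (f_2(z_2) - f_1(zh)).  Here
   d <= alpha_2, so d c(z_2, zh) <= b, and f_2(z_2) - f_2(zh) is controlled by the
   growth condition (p = 1) or by a supergradient at zh (p > 1).  The other
   direction follows by exchanging the two indices.

   All maxima must be shown to be attained.  Supergradients, which exist by a
   finite-dimensional Hahn-Banach argument, make the concave functions upper
   semicontinuous, and the growth of c makes the feasible sets compact. *)
Require Import Defs.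
From HB Require Import structures.
From mathcomp Require Import all_boot all_order all_algebra.
From mathcomp Require Import all_classical all_reals all_analysis.
From mathcomp Require Import ring lra.

Set Implicit Arguments.
Unset Strict Implicit.
Unset Printing Implicit Defensive.

Import Order.TTheory GRing.Theory Num.Theory.
Import numFieldNormedType.Exports.

Local Open Scope classical_set_scope.
Local Open Scope ring_scope.

Definition lsc_in (R : realType) (T : topologicalType) (D : set T)
    (f : T -> R) :=
  forall z, D z -> forall a, a < f z -> \forall w \near z, D w -> a < f w.

Lemma lsc_in_min (R : realType) (T : topologicalType) (D : set T)
    (f : T -> R) :
  D !=set0 -> compact D -> lsc_in D f ->
  exists2 z, D z & forall w, D w -> f z <= f w.
Proof.
move=> D0 cD lf.
pose B s := D `&` [set w | f w <= f s].
have FB : ProperFilter (filter_from D B).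
  apply: filter_from_proper.
    apply: filter_from_filter => [|s t Ds Dt]; first exact: D0.
    have [st|/ltW ts] := leP (f s) (f t).
      by exists s => // w [Dw /= ws]; do 2!split=> //=; exact: le_trans st.
    by exists t => // w [Dw /= wt]; do 2!split=> //=; exact: le_trans ts.
  by move=> s Ds; exists s; split => /=.
have [|z [Dz cz]] := cD _ FB.
  by have [s Ds] := D0; exists s => // w [].
exists z => // w Dw; rewrite leNgt; apply/negP => wz.
have [|v [[Dv /= vw] /(_ Dv)]] := cz (B w) _ _ (lf _ Dz _ wz).
  by exists w.
by rewrite ltNge vw.
Qed.

Lemma lsc_in_sub (R : realType) (T : topologicalType) (D E : set T)
    (f : T -> R) : E `<=` D -> lsc_in D f -> lsc_in E f.
Proof.
move=> ED lf z /ED Dz a /(lf _ Dz a).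
by apply: filterS => w + /ED.
Qed.

Lemma lsc_in_sublevel_closed (R : realType) (T : topologicalType) (D : set T)
    (f : T -> R) (u : R) :
  closed D -> lsc_in D f -> closed (D `&` [set z | f z <= u]).
Proof.
move=> cD lf z cz.
have Dz : D z by apply: cD => V /cz [w [[Dw _] Vw]]; exists w.
split=> //=; rewrite leNgt; apply/negP => /(lf _ Dz).
by move=> /cz[w [[Dw /= wu] /(_ Dw)]]; rewrite ltNge wu.
Qed.

Lemma lsc_in_wsum (R : realType) (T : topologicalType) (D : set T)
    (f g : T -> R) (a b : R) : 0 < a -> 0 < b ->
  lsc_in D f -> lsc_in D g ->
  lsc_in (D `*` D) (fun z => a * f z.1 + b * g z.2).
Proof.
move=> a0 b0 lf lg [z1 z2] [/= D1 D2] t tz.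
pose e := (a * f z1 + b * g z2 - t) / 2.
have e0 : 0 < e by rewrite divr_gt0// subr_gt0.
have h1 : f z1 - e / a < f z1 by rewrite ltrBlDr ltrDl divr_gt0.
have h2 : g z2 - e / b < g z2 by rewrite ltrBlDr ltrDl divr_gt0.
exists ([set w | D w -> f z1 - e / a < f w], [set w | D w -> g z2 - e / b < g w]).
  by split; [exact: lf|exact: lg].
move=> [w1 w2] [/= W1 W2] [/= /W1 k1 /W2 k2].
move: k1 k2; rewrite -(ltr_pM2l a0) -(ltr_pM2l b0 (g z2 - _)).
rewrite !mulrBr ![_ * (e / _)]mulrC !divfK ?gt_eqF// /e.
lra.
Qed.

Lemma convex_function_le (R : realType) (V : lmodType R) (D : set V)
    (f : V -> R) (x y : V) (t : R) :
  convex_function D f -> D x -> D y -> 0 <= t -> t <= 1 ->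
  f (t *: x + (1 - t) *: y) <= t * f x + (1 - t) * f y.
Proof.
move=> cf Dx Dy t0 t1.
exact: (cf (Itv01 t0 t1) x y (mem_set Dx) (mem_set Dy)).
Qed.

Lemma concave_function_ge (R : realType) (V : lmodType R)
    (f : V -> R) (x y : V) (t : R) :
  concave_function setT f -> 0 <= t -> t <= 1 ->
  t * f x + (1 - t) * f y <= f (t *: x + (1 - t) *: y).
Proof.
move=> cf t0 t1; have := convex_function_le cf (I : setT x) (I : setT y) t0 t1.
by rewrite !mulrN -opprD lerN2.
Qed.

Lemma dotDr (R : realType) m (a v w : 'rV[R]_m) :
  dot a (v + w) = dot a v + dot a w.
Proof. by rewrite -big_split; apply: eq_bigr => j _; rewrite mxE mulrDr. Qed.

Lemma dotDl (R : realType) m (a v w : 'rV[R]_m) :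
  dot (v + w) a = dot v a + dot w a.
Proof. by rewrite -big_split; apply: eq_bigr => j _; rewrite mxE mulrDl. Qed.

Lemma dotZr (R : realType) m (a : R) (v w : 'rV[R]_m) :
  dot v (a *: w) = a * dot v w.
Proof. by rewrite mulr_sumr; apply: eq_bigr => j _; rewrite mxE mulrCA. Qed.

Lemma dotZl (R : realType) m (a : R) (v w : 'rV[R]_m) :
  dot (a *: v) w = a * dot v w.
Proof. by rewrite mulr_sumr; apply: eq_bigr => j _; rewrite mxE mulrA. Qed.

Lemma dot_delta (R : realType) m (v : 'rV[R]_m) (k : 'I_m) :
  dot v (delta_mx ord0 k) = v ord0 k.
Proof.
rewrite /dot (bigD1 k)//= big1 ?addr0 => [|j /negPf jk].
  by rewrite mxE !eqxx mulr1.
by rewrite mxE eqxx jk mulr0.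
Qed.

Lemma dotC (R : realType) m (v w : 'rV[R]_m) : dot v w = dot w v.
Proof. by apply: eq_bigr => j _; rewrite mulrC. Qed.

Lemma dot_continuous (R : realType) m :
  continuous (fun vw : 'rV[R]_m * 'rV[R]_m => dot vw.1 vw.2).
Proof.
move=> vw; apply: cvg_big => [|j _]; first exact: add_continuous; apply: cvgM.
  apply: (@continuous_comp _ _ _ fst (fun v : 'rV[R]_m => v ord0 j)).
    exact: cvg_fst.
  exact: coord_continuous.
apply: (@continuous_comp _ _ _ snd (fun v : 'rV[R]_m => v ord0 j)).
  exact: cvg_snd.
exact: coord_continuous.
Qed.

Lemma dot_continuousr (R : realType) m (v : 'rV[R]_m) : continuous (dot v).
Proof.
move=> w; have Fw : Filter (nbhs w) by exact: nbhs_filter.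
apply: cvg_big => [|j _]; first exact: add_continuous.
apply: cvgM; first exact: cvg_cst.
exact: coord_continuous.
Qed.

(* Finite-dimensional Hahn-Banach: xi is built one coordinate at a time. *)
Lemma convex_function_minorant (R : realType) m (h : 'rV[R]_m -> R) :
  convex_function setT h -> 0 <= h 0 ->
  exists xi, forall v, dot xi v <= h v.
Proof.
move=> ch h0.
pose S k := [set v : 'rV[R]_m | forall j : 'I_m, (k <= j)%N -> v ord0 j = 0].
suff H k : (k <= m)%N -> exists xi, forall v, S k v -> dot xi v <= h v.
  have [xi xiP] := H m (leqnn m).
  by exists xi => v; apply: xiP => j; rewrite leqNgt ltn_ord.
elim: k => [_|k IH km].
  exists 0 => v v0; have -> : v = 0 by apply/rowP => j; rewrite v0// mxE.
  by rewrite /dot big1// => j _; rewrite mxE mul0r.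
have [xi xiP] := IH (ltnW km).
pose e : 'rV[R]_m := delta_mx ord0 (Ordinal km).
have S0 : S k 0 by move=> j _; rewrite mxE.
have Sconv (t : R) v w : S k v -> S k w -> S k (t *: v + (1 - t) *: w).
  by move=> Sv Sw j kj; rewrite !mxE Sv// Sw// !mulr0 addr0.
have key v w (s t : R) : S k v -> S k w -> 0 < s -> 0 < t ->
    (dot xi v - h (v - s *: e)) / s <= (h (w + t *: e) - dot xi w) / t.
  move=> Sv Sw s0 t0; have st0 : 0 < s + t by rewrite addr_gt0.
  have st0' : s + t != 0 by rewrite gt_eqF.
  pose l : R := t / (s + t).
  have l1 : 1 - l = s / (s + t) by rewrite /l; field.
  have l01 : 0 <= l <= 1.
    by rewrite -[l <= 1]subr_ge0 l1 !divr_ge0 ?ltW.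
  case/andP: l01 => l0 l1'.
  have := convex_function_le (x := v - s *: e) (y := w + t *: e) ch I I l0 l1'.
  have -> : l *: (v - s *: e) + (1 - l) *: (w + t *: e) = l *: v + (1 - l) *: w.
    rewrite l1 /l !scalerDr scalerN !scalerA addrACA -[RHS]addr0; congr (_ + _).
    by rewrite -scaleNr -scalerDl (_ : _ + _ = 0) ?scale0r//; field.
  move=> /(le_trans (xiP _ (Sconv l v w Sv Sw))).
  rewrite dotDr !dotZr l1 /l => H.
  rewrite ler_pdivrMr// mulrAC ler_pdivlMr//.
  have := ler_wpM2r (ltW st0) H.
  rewrite !mulrDl ![_ / (s + t) * _ * (s + t)]mulrAC !divfK//.
  lra.
pose L := [set x : R | exists v (s : R), [/\ S k v, 0 < s &
  x = (dot xi v - h (v - s *: e)) / s]].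
have Lub w (t : R) : S k w -> 0 < t -> ubound L ((h (w + t *: e) - dot xi w) / t).
  by move=> Sw t0 _ [v [s [Sv s0 ->]]]; exact: key.
have L0 : L !=set0 by exists ((dot xi 0 - h (0 - 1 *: e)) / 1), 0, 1.
pose a := sup L.
exists (xi + (a - xi ord0 (Ordinal km)) *: e) => v Sv.
pose t := v ord0 (Ordinal km); pose w := v - t *: e.
have ekk : e ord0 (Ordinal km) = 1 by rewrite mxE !eqxx.
have Sw : S k w.
  move=> j; rewrite leq_eqVlt => /predU1P[kj|kj].
    have -> : j = Ordinal km by apply/val_inj; rewrite /= kj.
    by rewrite !mxE !eqxx mulr1 subrr.
  rewrite !mxE Sv// eqxx (_ : j == _ = false) ?mulr0 ?subrr//.
  by apply/negbTE; rewrite -val_eqE/= gtn_eqF.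
have vE : v = w + t *: e by rewrite /w subrK.
have -> : dot (xi + (a - xi ord0 (Ordinal km)) *: e) v = dot xi w + t * a.
  rewrite dotDl dotZl (dotC e) dot_delta -/t {1}vE dotDr dotZr dot_delta.
  ring.
have [t0|t0|t0] := ltgtP t 0.
- have Nt0 : 0 < - t by rewrite oppr_gt0.
  have : (dot xi w - h v) / (- t) <= a.
    apply: ub_le_sup; first by exists ((h (0 + 1 *: e) - dot xi 0) / 1); exact: Lub.
    by exists w, (- t); split=> //; rewrite scaleNr opprK -vE.
  rewrite ler_pdivrMr//; lra.
- have : a <= (h v - dot xi w) / t.
    by apply: ge_sup => //; rewrite vE; exact: Lub.
  rewrite ler_pdivlMr//; lra.
- by rewrite t0 mul0r addr0 vE t0 scale0r addr0; exact: xiP.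
Qed.

Lemma superdifferential_nonempty (R : realType) m (f : 'rV[R]_m -> R) z :
  concave_function setT f -> superdifferential f z !=set0.
Proof.
move=> cf; pose h v := f z - f (z + v).
have hP (t : R) x y : 0 <= t -> t <= 1 ->
    h (t *: x + (1 - t) *: y) <= t * h x + (1 - t) * h y.
  move=> t0 t1; have := concave_function_ge (z + x) (z + y) cf t0 t1.
  have -> : t *: (z + x) + (1 - t) *: (z + y) = z + (t *: x + (1 - t) *: y).
    by rewrite !scalerDr addrACA -scalerDl [_ + (1 - _)]addrC subrK scale1r.
  rewrite /h; lra.
have ch : convex_function setT h by move=> t x y _ _; exact: hP.
have [|xi xiP] := convex_function_minorant ch.
  by rewrite /h addr0 subrr.
exists (- xi) => w; have := xiP (w - z); rewrite /h [z + _]addrC subrK.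
by rewrite -[- xi]scaleN1r dotZl; lra.
Qed.

Lemma concave_function_lsc (R : realType) m (f : 'rV[R]_m -> R)
    (D : set 'rV[R]_m) :
  concave_function setT f -> lsc_in D (fun z => - f z).
Proof.
move=> cf z _ a az; have [xi xiP] := superdifferential_nonempty z cf.
have e0 : 0 < - f z - a by rewrite subr_gt0.
have /cvgrPdist_lt/(_ _ e0) := @dot_continuousr _ _ xi z.
apply: filterS => w; rewrite distrC => /(le_lt_trans (ler_norm _)) H _.
have := xiP w; rewrite dotDr -[- z]scaleN1r dotZr; lra.
Qed.

Lemma coord_le_norm (R : realType) m (v : 'rV[R]_m) j : `|v ord0 j| <= `|v|.
Proof.
rewrite [leRHS]/Num.norm /= mx_normrE; apply/bigmax_geP; right => /=.
by exists (ord0, j).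
Qed.

Lemma closed_coord_bounded_compact (R : realType) m (A : set 'rV[R]_m) (M : R) :
  closed A -> (forall v j, A v -> `|v ord0 j| <= M) -> compact A.
Proof.
move=> cA AM; pose B (j : 'I_m) := `[- M, M]%classic.
have cB : compact [set v : 'rV[R]_m | forall j, B j (v ord0 j)].
  by apply: rV_compact => j; exact: segment_compact.
apply: subclosed_compact cA cB _ => v Av j.
by rewrite /B /= in_itv/= -ler_norml; exact: AM.
Qed.

Lemma is_norm0 (R : realType) m (nu : 'rV[R]_m -> R) : is_norm nu -> nu 0 = 0.
Proof. by move=> hn; rewrite -(scale0r 0) (norm_homogeneous hn) normr0 mul0r. Qed.

Lemma is_normN (R : realType) m (nu : 'rV[R]_m -> R) v :
  is_norm nu -> nu (- v) = nu v.
Proof.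
by move=> hn; rewrite -scaleN1r (norm_homogeneous hn) normrN1 mul1r.
Qed.

Lemma is_norm_ge0 (R : realType) m (nu : 'rV[R]_m -> R) v :
  is_norm nu -> 0 <= nu v.
Proof.
move=> hn; have := norm_triangle hn v (- v).
by rewrite subrr (is_norm0 hn) (is_normN _ hn); lra.
Qed.

Lemma is_norm_le_norm (R : realType) m (nu : 'rV[R]_m -> R) :
  is_norm nu -> exists2 L, 0 < L & forall v, nu v <= L * `|v|.
Proof.
move=> hn; pose L := \sum_(j < m) nu (delta_mx ord0 j).
have L0 : 0 <= L by apply: sumr_ge0 => j _; exact: is_norm_ge0.
exists (L + 1) => [|v]; first by rewrite ltr_wpDl.
apply: (@le_trans _ _ (L * `|v|)); last by rewrite ler_wpM2r// lerDl.
rewrite {1}[v]row_sum_delta /L mulr_suml.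
apply: (big_ind2 (fun x y => nu x <= y)) => [|x a y b xa yb|j _].
- by rewrite is_norm0.
- by apply: le_trans (norm_triangle hn _ _) _; exact: lerD.
- rewrite (norm_homogeneous hn) mulrC ler_wpM2l ?is_norm_ge0//.
  exact: coord_le_norm.
Qed.

Lemma is_norm_continuous (R : realType) m (nu : 'rV[R]_m -> R) :
  is_norm nu -> continuous nu.
Proof.
move=> hn z; have [L L0 nuL] := is_norm_le_norm hn.
have Fz : Filter (nbhs z) by exact: nbhs_filter.
apply/cvgrPdist_lt => e e0.
have eL : 0 < e / L by rewrite divr_gt0.
have /cvgrPdist_lt/(_ _ eL) := @cvg_id _ (nbhs z); apply: filterS => w zw.
have nuzw : nu (z - w) < e.
  by apply: le_lt_trans (nuL _) _; rewrite mulrC -ltr_pdivlMr.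
have := norm_triangle hn (z - w) w; have := norm_triangle hn (- (z - w)) z.
rewrite opprB !subrK -opprB (is_normN _ hn) => ? ?.
by rewrite ltr_norml; apply/andP; split; lra.
Qed.

Lemma norm_le_is_norm (R : realType) m (nu : 'rV[R]_m -> R) :
  is_norm nu -> exists2 k, 0 < k & forall v, `|v| <= k * nu v.
Proof.
move=> hn; pose S := [set v : 'rV[R]_m | `|v| = 1].
have normalize v : v != 0 -> S (`|v|^-1 *: v).
  by move=> v0; rewrite /S /= normrZ normfV normr_id mulVf// normr_eq0.
have [Se|S0] := eqVneq S set0.
  rewrite Se in normalize.
  exists 1 => // v; have [->|/normalize//] := eqVneq v 0.
  by rewrite normr0 mul1r is_norm_ge0.
have cS : compact S.
  apply: (@closed_coord_bounded_compact _ _ _ 1).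
    apply: (@preimage_closed _ _ (fun v : 'rV[R]_m => `|v|) [set 1]).
      by move=> v _; exact: norm_continuous.
    exact: closed_eq.
  by move=> v j /= <-; exact: coord_le_norm.
have /set0P S0' := S0.
have [|v /set_mem Sv vmin] := @EVT_min_rV _ _ nu _ S0' cS.
  by apply: continuous_subspaceT; exact: is_norm_continuous.
have nuv : 0 < nu v.
  rewrite lt_neqAle is_norm_ge0// andbT eq_sym; apply/eqP => /(norm_definite hn) v0.
  by move: Sv; rewrite /S /= v0 normr0 => /esym/eqP; rewrite oner_eq0.
exists (nu v)^-1 => [|w]; first by rewrite invr_gt0.
have [->|w0] := eqVneq w 0; first by rewrite normr0 (is_norm0 hn) mulr0.
have := vmin _ (mem_set (normalize _ w0)).
rewrite (norm_homogeneous hn) normfV normr_id ler_pdivlMl ?normr_gt0//.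
by rewrite ler_pdivlMl// mulrC.
Qed.

Lemma le_dual_norm (R : realType) m (nu : 'rV[R]_m -> R) (xi v : 'rV[R]_m) :
  is_norm nu -> nu v <= 1 -> dot xi v <= dual_norm nu xi.
Proof.
move=> hn v1; have [k k0 nuk] := norm_le_is_norm hn.
apply: ub_le_sup; last by exists v.
exists (\sum_(j < m) `|xi ord0 j| * k) => _ [w /= w1 <-].
apply: ler_sum => j _; apply: le_trans (ler_norm _) _.
rewrite normrM ler_wpM2l//; apply: le_trans (coord_le_norm _ _) _.
apply: le_trans (nuk w) _; rewrite -[leRHS]mulr1 ler_wpM2l// ltW//.
Qed.

Lemma dot_le_dual_norm (R : realType) m (nu : 'rV[R]_m -> R)
    (xi v : 'rV[R]_m) :
  is_norm nu -> dot xi v <= dual_norm nu xi * nu v.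
Proof.
move=> hn; have [nuv0|nuv0] := eqVneq (nu v) 0.
  by rewrite (norm_definite hn nuv0) (is_norm0 hn) mulr0 -(scale0r 0) dotZr mul0r.
have nuv : 0 < nu v by rewrite lt_neqAle eq_sym nuv0 is_norm_ge0.
rewrite -ler_pdivrMr// mulrC -dotZr; apply: le_dual_norm => //.
by rewrite (norm_homogeneous hn) normfV ger0_norm ?is_norm_ge0// mulVf.
Qed.

Lemma superdifferential_compact (R : realType) m (f : 'rV[R]_m -> R) z :
  compact (superdifferential f z).
Proof.
pose M (j : 'I_m) := `|f z - f (z + delta_mx ord0 j)| +
                     `|f z - f (z - delta_mx ord0 j)|.
apply: (@closed_coord_bounded_compact _ _ _ (\sum_j M j)).
  have -> : superdifferential f z =
      \bigcap_w ((fun xi => dot xi (w - z)) @^-1` [set y | f w - f z <= y]).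
    by apply/seteqP; split => xi h w; have := h w; rewrite /= lerBlDl; exact.
  apply: closed_bigI => w _; apply: preimage_closed; last exact: closed_ge.
  by move=> xi _; under eq_fun do rewrite dotC; exact: dot_continuousr.
move=> xi j hxi; apply: (@le_trans _ _ (M j)); last first.
  by rewrite (bigD1 j)//= lerDl sumr_ge0// => l _; rewrite addr_ge0.
have := hxi (z + delta_mx ord0 j); have := hxi (z - delta_mx ord0 j).
rewrite ![_ - z]addrC !addKr -scaleN1r dotZr dot_delta scaleN1r.
have := ler_norm (f z - f (z + delta_mx ord0 j)).
have := ler_norm (f z - f (z - delta_mx ord0 j)).
have := normr_ge0 (f z - f (z + delta_mx ord0 j)).
have := normr_ge0 (f z - f (z - delta_mx ord0 j)).
by rewrite ler_norml /M => *; apply/andP; split; lra.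
Qed.

Lemma dual_norm_superdifferential_max (R : realType) m (nu : 'rV[R]_m -> R)
    (f : 'rV[R]_m -> R) z :
  is_norm nu -> concave_function setT f ->
  exists2 xi, superdifferential f z xi &
    forall xi', superdifferential f z xi' -> dual_norm nu xi' <= dual_norm nu xi.
Proof.
move=> hn cf; pose B := [set v | nu v <= 1].
have B0 : B 0 by rewrite /B /= (is_norm0 hn).
have cB : compact B.
  have [k k0 nuk] := norm_le_is_norm hn.
  apply: (@closed_coord_bounded_compact _ _ _ k).
    apply: (@preimage_closed _ _ nu [set x | x <= 1]); last exact: closed_le.
    by move=> v _; exact: is_norm_continuous.
  move=> v j v1; apply: le_trans (coord_le_norm _ _) _.
  by apply: le_trans (nuk v) _; rewrite -[leRHS]mulr1 ler_wpM2l// ltW.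
have cSB := compact_setX (@superdifferential_compact _ _ f z) cB.
have [xi0 hxi0] := superdifferential_nonempty z cf.
have [||[xi v] /set_mem[/= hxi Bv] ximax] :=
    @compact_EVT_max _ _ (fun vw => dot vw.1 vw.2) _ _ cSB.
- by exists (xi0, 0).
- by apply: continuous_subspaceT; exact: dot_continuous.
exists xi => // xi' hxi'; apply: ge_sup; first by exists (dot xi' 0), 0.
move=> _ [w Bw <-]; apply: le_trans (le_dual_norm xi hn Bv).
exact: (ximax (xi', w) (mem_set (conj hxi' Bw))).
Qed.

Lemma maximum_fin_ge (R : realType) (I : finType) (P : set I) (F : I -> R) i :
  P i -> F i <= maximum [set F k | k in P].
Proof.
move=> Pi; have [_ ub] : [set F k | k in P] (maximum [set F k | k in P]) /\
    ubound [set F k | k in P] (maximum [set F k | k in P]).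
  apply: maximumP.
  case: (@arg_maxP _ _ _ i (fun j => j \in P) F (mem_set Pi)) => j /set_mem Pj jmax.
  exists (F j); split; first by exists j.
  by move=> _ [k /mem_set Pk <-]; exact: jmax.
by apply: ub; exists i.
Qed.

Lemma transport_cost_lsc (R : realType) m (Z : set 'rV[R]_m)
    (c : 'rV[R]_m -> 'rV[R]_m -> R) zh :
  transport_cost Z c -> Z zh -> lsc_in Z (c^~ zh).
Proof.
move=> hc Zzh z Zz a az.
have ZZ : (Z `*` Z) (z, zh) by [].
have [|V nV cV] := cost_lsc hc (x := (z, zh)) (a := a); first by rewrite lte_fin.
have : within (Z `*` Z) (nbhs (z, zh)) V by rewrite (nbhs_subspace_in ZZ).
move=> -[[A B] /= [nA nB] AB].
apply: filterS nA => w Aw Zw; rewrite -lte_fin; apply: (cV (w, zh)).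
by apply: (AB (w, zh)) => //; split => //=; exact: nbhs_singleton.
Qed.

Lemma transport_cost_sublevel_compact (R : realType) m (Z : set 'rV[R]_m)
    (c : 'rV[R]_m -> 'rV[R]_m -> R) (nu : 'rV[R]_m -> R) (p : R) zh u :
  closed Z -> transport_cost Z c -> Z zh -> is_norm nu -> 1 <= p ->
  (forall z zh, Z z -> Z zh -> nu (z - zh) `^ p <= c z zh) ->
  compact (Z `&` [set z | c z zh <= u]).
Proof.
move=> cZ hc Zzh hn p1 cge; have [k k0 nuk] := norm_le_is_norm hn.
apply: (@closed_coord_bounded_compact _ _ _ (k * (1 + u) + `|zh|)).
  exact: (lsc_in_sublevel_closed cZ (transport_cost_lsc hc Zzh)).
move=> z j [Zz /= cu]; apply: le_trans (coord_le_norm _ _) _.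
have -> : z = (z - zh) + zh by rewrite subrK.
apply: le_trans (ler_normD _ _) _; rewrite lerD2r.
apply: le_trans (nuk _) _; rewrite (ler_wpM2l (ltW k0))// => {j}.
have u0 : 0 <= u by apply: le_trans cu; exact: (cost_ge0 hc).
have [nu1|/ltW nu1] := leP (nu (z - zh)) 1; first by apply: le_trans nu1 _; rewrite lerDl.
have : nu (z - zh) <= u.
  by apply: le_trans cu; apply: le_trans (cge _ _ Zz Zzh); exact: le1r_powR.
by move=> /le_trans; apply; rewrite lerDr.
Qed.

Definition weighted_maximum (R : realType) (T : Type) (Z : set T)
    (h f1 f2 : T -> R) (b : R) (a : R * R) (V : R) :=
  (exists z1 z2, [/\ Z z1, Z z2, a.1 * h z1 + a.2 * h z2 <= b &
    V = a.1 * f1 z1 + a.2 * f2 z2]) /\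
  (forall z1 z2, Z z1 -> Z z2 -> a.1 * h z1 + a.2 * h z2 <= b ->
    a.1 * f1 z1 + a.2 * f2 z2 <= V).

Lemma weighted_maximum_swap (R : realType) (T : Type) (Z : set T)
    (h f1 f2 : T -> R) (b : R) (a : R * R) (V : R) :
  weighted_maximum Z h f1 f2 b a V ->
  weighted_maximum Z h f2 f1 b (a.2, a.1) V.
Proof.
move=> [[z1 [z2 [Z1 Z2 zb ->]]] ub]; split.
  by exists z2, z1; split => //=; rewrite addrC.
by move=> w1 w2 W1 W2 /=; rewrite addrC => wb; rewrite addrC; exact: ub.
Qed.

Section local_problem.
Context (R : realType) (m : nat) (Z : set 'rV[R]_m).
Context (c : 'rV[R]_m -> 'rV[R]_m -> R) (f1 f2 : 'rV[R]_m -> R) (zh : 'rV[R]_m).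
Hypotheses (hc : transport_cost Z c) (cZ : closed Z) (Zzh : Z zh).
Hypothesis cS : forall u, compact (Z `&` [set z | c z zh <= u]).
Hypotheses (cf1 : concave_function setT f1) (cf2 : concave_function setT f2).

Lemma Psi_max (a beta : R * R) : 0 < a.1 -> 0 < a.2 ->
  0 <= beta.1 -> 0 <= beta.2 ->
  (exists z1 z2, [/\ Z z1, Z z2, a.1 * c z1 zh <= beta.1, a.2 * c z2 zh <= beta.2 &
    Psi Z c f1 f2 zh a beta = a.1 * f1 z1 + a.2 * f2 z2]) /\
  (forall z1 z2, Z z1 -> Z z2 -> a.1 * c z1 zh <= beta.1 -> a.2 * c z2 zh <= beta.2 ->
    a.1 * f1 z1 + a.2 * f2 z2 <= Psi Z c f1 f2 zh a beta).
Proof.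
move=> a1 a2 b1 b2.
have fmax (f : 'rV[R]_m -> R) (t u : R) : concave_function setT f ->
    0 < t -> 0 <= u -> exists z, [/\ Z z, t * c z zh <= u &
      forall w, Z w -> t * c w zh <= u -> f w <= f z].
  move=> cf t0 u0.
  have [|z [Zz /= zu] zmin] :=
      lsc_in_min _ (@cS (u / t)) (concave_function_lsc (D := _) cf).
    by exists zh; split => //=; rewrite (cost_diag hc)// divr_ge0// ltW.
  exists z; split => //; first by rewrite mulrC -ler_pdivlMr.
  move=> w Zw; rewrite mulrC -ler_pdivlMr// => wu.
  by rewrite -lerN2; apply: zmin.
have [z1 [Z1 zb1 z1max]] := fmax f1 _ _ cf1 a1 b1.
have [z2 [Z2 zb2 z2max]] := fmax f2 _ _ cf2 a2 b2.
have sub z : zh + (z - zh) = z by rewrite addrC subrK.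
have PsiE : Psi Z c f1 f2 zh a beta = a.1 * f1 z1 + a.2 * f2 z2.
  apply: maximumE; first by exists (z1 - zh, z2 - zh); rewrite /= ?sub.
  move=> _ [[v1 v2] /= [? ? ? ?] <-].
  by rewrite lerD// ler_pM2l//; [exact: z1max|exact: z2max].
split; first by exists z1, z2.
move=> w1 w2 *; rewrite PsiE.
by rewrite lerD// ler_pM2l//; [exact: z1max|exact: z2max].
Qed.

Lemma Phi_weighted_maximum (b : R) (a : R * R) :
  0 <= b -> 0 < a.1 -> 0 < a.2 ->
  weighted_maximum Z (c^~ zh) f1 f2 b a (Phi Z c f1 f2 zh b a).
Proof.
move=> b0 a1 a2; have c0 z : Z z -> 0 <= c z zh by move=> ?; exact: (cost_ge0 hc).
pose h z := a.1 * c z.1 zh + a.2 * c z.2 zh.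
pose D := (Z `*` Z) `&` [set z | h z <= b].
have lc := transport_cost_lsc hc Zzh.
have cD : compact D.
  have clD : closed D.
    apply: (lsc_in_sublevel_closed _ (lsc_in_wsum a1 a2 lc lc)).
    apply: (@closedI _ (fst @^-1` Z) (snd @^-1` Z)); apply: preimage_closed => //.
      by move=> z _; exact: cvg_fst.
    by move=> z _; exact: cvg_snd.
  apply: subclosed_compact clD (compact_setX (@cS (b / a.1)) (@cS (b / a.2))) _.
  move=> [z1 z2] [[/= Z1 Z2]]; rewrite /h /= => zb.
  have := mulr_ge0 (ltW a1) (c0 _ Z1); have := mulr_ge0 (ltW a2) (c0 _ Z2).
  by move=> *; do 2!split=> //=; rewrite ler_pdivlMr// mulrC; lra.
have [|[z1 z2] [[/= Z1 Z2] zb] zmin] := lsc_in_min _ cD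
    (lsc_in_sub (@subIsetl _ _ _)
      (lsc_in_wsum a1 a2 (concave_function_lsc (D := Z) cf1)
        (concave_function_lsc (D := Z) cf2))).
  by exists (zh, zh); split => //; rewrite /h /= (cost_diag hc)// !mulr0 addr0.
have zmax w1 w2 : Z w1 -> Z w2 -> a.1 * c w1 zh + a.2 * c w2 zh <= b ->
    a.1 * f1 w1 + a.2 * f2 w2 <= a.1 * f1 z1 + a.2 * f2 z2.
  move=> W1 W2 wb; have := zmin (w1, w2) (conj (conj W1 W2) wb).
  by rewrite /= !mulrN -!opprD lerN2.
suff -> : Phi Z c f1 f2 zh b a = a.1 * f1 z1 + a.2 * f2 z2.
  by split => //; exists z1, z2.
have Psi_le beta : 0 <= beta.1 -> 0 <= beta.2 -> beta.1 + beta.2 = b ->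
    Psi Z c f1 f2 zh a beta <= a.1 * f1 z1 + a.2 * f2 z2.
  move=> t1 t2 tb; have [[w1 [w2 [W1 W2 wb1 wb2 ->]]] _] := Psi_max a1 a2 t1 t2.
  by apply: zmax => //; rewrite -tb lerD.
apply: maximumE; last by move=> _ [beta [t1 t2 tb] <-]; exact: Psi_le.
pose beta := (a.1 * c z1 zh, b - a.1 * c z1 zh).
have t1 : 0 <= beta.1 by rewrite mulr_ge0 ?c0// ltW.
have zb2 : a.2 * c z2 zh <= beta.2 by move: zb; rewrite /h /beta /=; lra.
have t2 : 0 <= beta.2 by apply: le_trans zb2; rewrite mulr_ge0 ?c0// ltW.
have tb : beta.1 + beta.2 = b by rewrite addrC subrK.
exists beta => //; apply/eqP; rewrite eq_le Psi_le//=.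
by have [_] := Psi_max a1 a2 t1 t2; apply.
Qed.

End local_problem.

Lemma weighted_maximum_diff_le (R : realType) m (Z : set 'rV[R]_m)
    (h f1 f2 : 'rV[R]_m -> R) (zh : 'rV[R]_m) (b B V V' : R) (a a' : R * R) :
  convex_set Z -> convex_function Z h -> (forall z, Z z -> 0 <= h z) ->
  Z zh -> h zh = 0 -> concave_function setT f1 ->
  0 < a.1 -> 0 < a'.2 -> a.1 + a.2 = 1 -> a'.1 + a'.2 = 1 -> a.1 <= a'.1 ->
  (forall z, Z z -> (a'.1 - a.1) * h z <= b ->
    (a'.1 - a.1) * (f2 z - f1 zh) <= B) ->
  weighted_maximum Z h f1 f2 b a V -> weighted_maximum Z h f1 f2 b a' V' ->
  V - V' <= B.
Proof.
move=> convZ convh h0 Zzh hzh cf1 a1 a2' aE aE' aa' hB.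
move=> [[z1 [z2 [Z1 Z2 zb ->]]] _] [_ ub].
have a1' : 0 < a'.1 by exact: lt_le_trans aa'.
pose t := a.1 / a'.1.
have t0 : 0 <= t by rewrite divr_ge0// ltW.
have t1 : t <= 1 by rewrite ler_pdivrMr// mul1r.
have a't : a'.1 * t = a.1 by rewrite mulrC divfK// gt_eqF.
pose w := t *: z1 + (1 - t) *: zh.
have Zw : Z w.
  by have := convZ z1 zh (Itv01 t0 t1) (mem_set Z1) (mem_set Zzh) => /set_mem.
have hw : a'.1 * h w <= a.1 * h z1.
  have := convex_function_le convh Z1 Zzh t0 t1.
  by rewrite hzh mulr0 addr0 -a't -mulrA ler_pM2l.
have fw : a.1 * f1 z1 + (a'.1 - a.1) * f1 zh <= a'.1 * f1 w.
  have := concave_function_ge z1 zh cf1 t0 t1.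
  by rewrite -/w -(ler_pM2l a1') -a't; lra.
have a2a : a'.2 <= a.2 by lra.
have hz2 : a'.2 * h z2 <= a.2 * h z2 by rewrite ler_wpM2r// h0.
have hd : (a'.1 - a.1) * h z2 <= b.
  have -> : a'.1 - a.1 = a.2 - a'.2 by lra.
  have := mulr_ge0 (ltW a1) (h0 _ Z1).
  have := mulr_ge0 (ltW a2') (h0 _ Z2).
  lra.
have := hB _ Z2 hd.
have := ub w z2 Zw Z2.
have -> : a.2 = 1 - a.1 by lra.
have a2E' : a'.2 = 1 - a'.1 by lra.
have wb : a'.1 * h w + a'.2 * h z2 <= b by lra.
move=> /(_ wb); rewrite a2E'; lra.
Qed.

Lemma weighted_maximum_dist_le (R : realType) m (Z : set 'rV[R]_m)
    (h f1 f2 : 'rV[R]_m -> R) (zh : 'rV[R]_m) (b B V V' : R) (a a' : R * R) :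
  convex_set Z -> convex_function Z h -> (forall z, Z z -> 0 <= h z) ->
  Z zh -> h zh = 0 -> concave_function setT f1 -> concave_function setT f2 ->
  [/\ 0 < a.1, 0 < a.2 & a.1 + a.2 = 1] ->
  [/\ 0 < a'.1, 0 < a'.2 & a'.1 + a'.2 = 1] ->
  (forall z, Z z -> `|a.1 - a'.1| * h z <= b ->
    `|a.1 - a'.1| * (f1 z - f2 zh) <= B /\
    `|a.1 - a'.1| * (f2 z - f1 zh) <= B) ->
  weighted_maximum Z h f1 f2 b a V -> weighted_maximum Z h f1 f2 b a' V' ->
  `|V - V'| <= B.
Proof.
move=> convZ convh h0 Zzh hzh cf1 cf2.
wlog aa' : a a' V V' / a.1 <= a'.1 => [wlg ha ha' hB hV hV'|].
  have [aa'|/ltW aa'] := leP a.1 a'.1; first exact: (wlg a a').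
  by rewrite distrC; apply: (wlg a' a) => // z; rewrite distrC; exact: hB.
move=> [a1 a2 aE] [a1' a2' aE']; rewrite distrC ger0_norm ?subr_ge0// => hB hV hV'.
have VV' : V - V' <= B.
  apply: (weighted_maximum_diff_le convZ convh h0 Zzh hzh cf1 a1 a2' aE aE' aa'
    _ hV hV') => z Zz zb.
  by have [] := hB _ Zz zb.
have V'V : V' - V <= B.
  have aE2 : a.2 - a'.2 = a'.1 - a.1 by lra.
  apply: (weighted_maximum_diff_le (zh := zh) (b := b) convZ convh h0 Zzh hzh cf2
    _ _ _ _ _ _ (weighted_maximum_swap hV') (weighted_maximum_swap hV)) => //=.
  - by rewrite addrC.
  - by rewrite addrC.
  - lra.
  - by move=> z Zz; rewrite aE2 => zb; have [] := hB _ Zz zb.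
rewrite ler_norml; apply/andP; split; lra.
Qed.

Lemma powR_subadditive (R : realType) (x y r : R) :
  0 <= x -> 0 <= y -> 0 <= r <= 1 -> (x + y) `^ r <= x `^ r + y `^ r.
Proof.
move=> x0 y0 /andP[r0 r1]; have [s0|s0] := eqVneq (x + y) 0.
  have -> : x = 0 by lra.
  have -> : y = 0 by lra.
  by rewrite addr0 lerDl powR_ge0.
have sp : 0 < x + y by rewrite lt_neqAle eq_sym s0 addr_ge0.
have part z : 0 <= z -> z <= x + y -> (x + y) `^ r * (z / (x + y)) <= z `^ r.
  move=> z0 zs; have [->|zN0] := eqVneq z 0; first by rewrite mul0r mulr0 powR_ge0.
  have zp : 0 < z by rewrite lt_neqAle eq_sym zN0.
  rewrite -{2}(divfK s0 z) powRM ?divr_ge0 ?(ltW sp)// mulrC ler_wpM2r ?powR_ge0//.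
  by apply: ger1_powR => //; rewrite divr_gt0//= ler_pdivrMr// mul1r.
apply: le_trans (lerD (part x x0 _) (part y y0 _)); rewrite ?lerDl ?lerDr//.
by rewrite -mulrDr -mulrDl divff// mulr1.
Qed.

Lemma mulr_powR_div (R : realType) (d b s : R) :
  0 < d -> 0 <= b -> d * (b / d) `^ s = b `^ s * d `^ (1 - s).
Proof.
move=> d0 b0; rewrite powRM ?invr_ge0 ?(ltW d0)// mulrCA; congr (_ * _).
have dN0 : (1 == s) ==> (d != 0) by rewrite (gt_eqF d0) implybT.
rewrite (powRB dN0) powRr1 ?(ltW d0)//; congr (_ * _).
by rewrite -powR_inv1 ?(ltW d0)// -powRrM mulN1r powRN.
Qed.

Lemma increment_le_Gconst (R : realType) (m K : nat)
    (f : 'I_K -> 'rV[R]_m -> R) (nu : 'rV[R]_m -> R) (zh z : 'rV[R]_m) k :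
  is_norm nu -> (forall k, concave_function setT (f k)) ->
  0 <= Gconst f nu zh /\ f k z - f k zh <= Gconst f nu zh * nu (z - zh).
Proof.
move=> hn cf.
have [xi hxi ximax] := dual_norm_superdifferential_max zh hn (cf k).
have xiG : dual_norm nu xi <= Gconst f nu zh.
  have := @maximum_fin_ge _ _ [set: 'I_K] (fun k => maximum
    [set dual_norm nu xi | xi in superdifferential (f k) zh]) k I.
  apply: le_trans; rewrite (@maximumE _ _ (dual_norm nu xi))//; first by exists xi.
  by move=> _ [xi' hxi' <-]; exact: ximax.
split.
  apply: le_trans xiG; rewrite -(mul0r (dot xi 0)) -dotZr scale0r.
  by apply: le_dual_norm => //; rewrite (is_norm0 hn).
have := hxi z; rewrite -lerBlDl => /le_trans; apply.
apply: le_trans (dot_le_dual_norm xi (z - zh) hn) _.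
by rewrite ler_wpM2r// is_norm_ge0.
Qed.

Lemma increment_le_Cconst (R : realType) (n m K : nat)
    (ell : 'I_K -> 'rV[R]_n -> 'rV[R]_m -> R) (x : 'rV[R]_n)
    (Z : set 'rV[R]_m) (nu : 'rV[R]_m -> R) (g : R) (z0 : 'rV[R]_m) (r : R)
    (zh z : 'rV[R]_m) k :
  is_norm nu -> growth_bound Z nu (loss ell x) g z0 r -> Z zh -> Z z ->
  let C := Cconst (fun k => ell k x) nu zh g z0 r in
  0 <= C /\ ell k x z - ell k x zh <= C + g * nu (z - zh) `^ r.
Proof.
move=> hn [g0 Zz0 /andP[r0 r1] gr] Zzh Zz C.
have ell_le w : Z w -> ell k x w <= g * (1 + nu (w - z0) `^ r).
  move=> /gr; apply: le_trans.
  exact: (@maximum_fin_ge _ _ [set: 'I_K] (fun k => ell k x w) k I).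
have CE : g + g * nu (zh - z0) `^ r - ell k x zh <= C.
  exact: (@maximum_fin_ge _ _ [set: 'I_K]
    (fun k => g + g * nu (zh - z0) `^ r - ell k x zh) k I).
split; first by have := ell_le _ Zzh; lra.
have tri : nu (z - z0) `^ r <= nu (z - zh) `^ r + nu (zh - z0) `^ r.
  apply: (@le_trans _ _ ((nu (z - zh) + nu (zh - z0)) `^ r)); last first.
    by apply: powR_subadditive; rewrite ?is_norm_ge0 ?r0 ?(ltW r1).
  apply: ge0_ler_powR; rewrite ?nnegrE ?addr_ge0 ?is_norm_ge0//.
  by have := norm_triangle hn (z - zh) (zh - z0); rewrite addrA subrK.
have := ell_le _ Zz; have := ler_wpM2l (ltW g0) tri; lra.
Qed.

Theorem lemma10 (R : realType) (n m N K : nat)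
  (X : set 'rV[R]_n) (Z : set 'rV[R]_m)
  (c : 'rV[R]_m -> 'rV[R]_m -> R) (hc : transport_cost Z c)
  (zhat : 'I_N -> 'rV[R]_m) (hzhat : forall i, Z (zhat i))
  (rho : R) (hrho : 0 < rho)
  (ell : 'I_K -> 'rV[R]_n -> 'rV[R]_m -> R)
  (nu : 'rV[R]_m -> R) (p : R)
  (hreg : regularity X Z c zhat rho ell nu p)
  (x : 'rV[R]_n) (hx : X x)
  (O : 'I_K -> 'rV[R]_m -> R -> R -> 'rV[R]_m * R)
  (hO : local_worst_case_oracle Z c (fun k => ell k x) O)
  (i : 'I_N) (k1 k2 : 'I_K) (hk : (k1 < k2)%N) (b : R) (hb : 0 <= b)
  (alpha alpha' : R * R)
  (halpha : [/\ 0 < alpha.1, 0 < alpha.2 & alpha.1 + alpha.2 = 1])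
  (halpha' : [/\ 0 < alpha'.1, 0 < alpha'.2 & alpha'.1 + alpha'.2 = 1]) :
  let f := fun k => ell k x in
  let Phi_i := Phi Z c (f k1) (f k2) (zhat i) b in
  let R_i := Rconst f (zhat i) in
  let G_i := Gconst f nu (zhat i) in
  (p = 1 -> forall (g : R) (z0 : 'rV[R]_m) (r : R),
     growth_bound Z nu (loss ell x) g z0 r ->
     let C_i := Cconst f nu (zhat i) g z0 r in
     `|Phi_i alpha - Phi_i alpha'| <=
       (R_i + 2 * C_i) * `|alpha.1 - alpha'.1|
       + 2 * g * b `^ r * `|alpha.1 - alpha'.1| `^ (1 - r)) /\
  (1 < p ->
     `|Phi_i alpha - Phi_i alpha'| <=
       R_i * `|alpha.1 - alpha'.1|
       + 2 * G_i * b `^ (p^-1) * `|alpha.1 - alpha'.1| `^ (1 - p^-1)).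
Proof.
move=> f Phi_i R_i G_i; set d := `|alpha.1 - alpha'.1|.
set zh := zhat i; have Zzh : Z zh by exact: hzhat.
have hn := reg_norm hreg; have p1 := reg_p hreg.
have cf k : concave_function setT (f k) by exact: (reg_ell_concave hreg).
have cZ := reg_Z_closed hreg; have cge := reg_cost_growth hreg.
have d0 : 0 <= d by exact: normr_ge0.
have c0 z : Z z -> 0 <= c z zh by move=> Zz; exact: (cost_ge0 hc).
have main B : (forall k z, Z z -> d * c z zh <= b ->
    d * (f k z - f k zh) <= B) -> `|Phi_i alpha - Phi_i alpha'| <= R_i * d + B.
  move=> hB; have cS u := transport_cost_sublevel_compact (u := u) cZ hc Zzh hn p1 cge.
  have maxi := Phi_weighted_maximum hc cZ Zzh cS (cf k1) (cf k2) hb.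
  have [a1 a2 _] := halpha; have [a1' a2' _] := halpha'.
  apply: (weighted_maximum_dist_le (reg_Z_convex hreg) (cost_convex hc Zzh) c0 Zzh
    (cost_diag hc Zzh) (cf k1) (cf k2) halpha halpha' _
    (maxi _ a1 a2) (maxi _ a1' a2')) => z Zz zb.
  have : `|f k1 zh - f k2 zh| <= R_i.
    exact: (@maximum_fin_ge _ _ [set kk : 'I_K * 'I_K | (kk.1 < kk.2)%N]
      (fun kk => `|f kk.1 zh - f kk.2 zh|) (k1, k2) hk).
  rewrite ler_norml => /andP[/(ler_wpM2l d0) h1 /(ler_wpM2l d0) h2].
  by have := hB k1 _ Zz zb; have := hB k2 _ Zz zb; rewrite -/d; split; lra.
have scaled z e : 0 <= e -> 0 < d -> Z z -> d * c z zh <= b ->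
    d * c z zh `^ e <= b `^ e * d `^ (1 - e).
  move=> e0 dp Zz zb; rewrite -mulr_powR_div// ler_wpM2l// ge0_ler_powR//.
  - by rewrite nnegrE c0.
  - by rewrite nnegrE divr_ge0.
  - by rewrite ler_pdivlMr// mulrC.
split=> [pE g z0 r gb /=|p1'].
  set C_i := Cconst f nu zh g z0 r.
  have [g0 _ /andP[r0 r1] _] := gb.
  rewrite mulrDl -addrA; apply: main => k z Zz zb.
  have [C0 fC] := increment_le_Cconst k hn gb Zzh Zz.
  have [dE|dN0] := eqVneq d 0.
    by rewrite dE mul0r mulr0 add0r !mulr_ge0// ?powR_ge0// ltW.
  have dp : 0 < d by rewrite lt_neqAle eq_sym dN0.
  have nur : nu (z - zh) `^ r <= c z zh `^ r.
    apply: (ge0_ler_powR r0); [by rewrite nnegrE is_norm_ge0|by rewrite nnegrE c0|].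
    by have := cge _ _ Zz Zzh; rewrite pE powRr1 ?is_norm_ge0.
  have := scaled z r r0 dp Zz zb; move: nur fC.
  move=> /(ler_wpM2l (ltW g0)) nur fC /(ler_wpM2l (ltW g0)) zr.
  have pos : 0 <= g * (b `^ r * d `^ (1 - r)) by rewrite !mulr_ge0 ?powR_ge0// ltW.
  have : d * (f k z - f k zh) <= d * (C_i + g * c z zh `^ r).
    by rewrite ler_wpM2l//; apply: le_trans fC _; rewrite lerD2l.
  have := mulr_ge0 d0 C0; rewrite -/C_i; lra.
apply: main => k z Zz zb; have pV : 0 <= p^-1 by rewrite invr_ge0; lra.
have [G0 fG] := increment_le_Gconst zh z k hn cf.
have [dE|dN0] := eqVneq d 0.
  by rewrite dE mul0r !mulr_ge0// ?powR_ge0.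
have dp : 0 < d by rewrite lt_neqAle eq_sym dN0.
have nuc : nu (z - zh) <= c z zh `^ p^-1.
  have := ge0_ler_powR pV _ _ (cge _ _ Zz Zzh).
  rewrite -powRrM divff ?powRr1 ?is_norm_ge0//; last by rewrite gt_eqF//; lra.
  by apply; rewrite nnegrE ?powR_ge0 ?c0.
have := scaled z _ pV dp Zz zb; move: nuc.
move=> /(ler_wpM2l G0) nuc /(ler_wpM2l G0) zp.
have pos : 0 <= G_i * (b `^ p^-1 * d `^ (1 - p^-1)) by rewrite !mulr_ge0 ?powR_ge0.
have : d * (f k z - f k zh) <= d * (G_i * c z zh `^ p^-1).
  by rewrite ler_wpM2l//; apply: le_trans fG _.
move: zp; rewrite -/G_i; lra.
Qed.
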